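(* Consider a connected network with $n$ nodes and $m$ edges, let $\Gamma_0=\max\left\{\frac{\Delta}{2},\frac{4\rho nL}{1+2\rho n}\right\}$, let $\rho>0$ be such that $\Gamma_0\le\frac{\Delta}{2}$, and assume that $L\ge 5\left(1+4\rho\frac{m}{n}\right)\frac{\Delta}{2}$. Then for any agents' data $r_1,\dots,r_n\in\mathbb{R}$ with average $\bar r=\frac1n\sum_{i=1}^n r_i$, the algorithm EBQ-CADMM (defined in the context) terminates and its returned values $t_1,\dots,t_n$ and $x_{BQ}$ satisfy $$t_1=\cdots=t_n\triangleq t^*$$ and $$\left|t^*+x_{BQ}-\bar r\right|\le\left(1+4\rho\frac{m}{n}\right)\frac{\Delta}{2}.$$
   Context: Network: a connected, simple, undirected graph with node set $\{1,\dots,n\}$ and $m$ edges; $\mathcal{N}_i$ denotes the set of neighbors of node $i$ (not containing $i$) and $|\mathcal N_i|$ its cardinality. Quantizer: fix a resolution $\Delta>0$ and let $\Lambda=\{t\Delta:t\in\mathbb{Z}\}$. The rounding quantizer $\mathcal{Q}:\mathbb{R}\to\Lambda$ is $\mathcal{Q}(x)=t\Delta$ if $(t-\frac12)\Delta<x\le(t+\frac12)\Delta$. Let $\mathcal{X}=[-L,L]$ with $0<L<\infty$ a multiple of $\Delta$, let $\Lambda_{\mathcal X}=[-L,L]\cap\Lambda$, and let $\mathcal{T}_{\mathcal X}:\mathbb{R}\to\mathcal X$ be the projection mapping a real number to the nearest point of $\mathcal X$. The bounded quantizer is $\mathcal{Q}_b=\mathcal{Q}\circ\mathcal{T}_{\mathcal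 X}:\mathbb{R}\to\Lambda_{\mathcal X}$. BQ-CADMM with data $(r_i)$ and parameter $\rho>0$: initialize $x_i^0=0$ and $\alpha_i^0=0$ for $i=1,\dots,n$, and for $k=0,1,2,\dots$ and every $i$ set $$x_i^{k+1}=\frac{1}{1+2\rho|\mathcal N_i|}\Big(\rho|\mathcal N_i|\mathcal{Q}_b(x_i^k)+\rho\sum_{j\in\mathcal N_i}\mathcal{Q}_b(x_j^k)-\alpha_i^k+r_i\Big),$$ $$\alpha_i^{k+1}=\alpha_i^k+\rho\Big(|\mathcal N_i|\mathcal{Q}_b(x_i^{k+1})-\sum_{j\in\mathcal N_i}\mathcal{Q}_b(x_j^{k+1})\Big).$$ Consensus value of a BQ-CADMM run: after finitely many iterations, a run either converges, meaning there is $k_0$ such that $\mathcal{Q}_b(x_1^k)=\cdots=\mathcal{Q}_b(x_n^k)=x_Q^*$ for all $k\ge k_0$, in which case its consensus value is $x_Q^*$; or it cycles, meaning there are $k_0$ and a finite period $T\ge2$ with $x_i^{k+T}=x_i^k$ for all $i$ and $k\ge k_0$, in which case its consensus value is the period average $\bar x_Q^*=\frac1T\sum_{l=1}^T\mathcal{Q}_b(x_i^{k+l})$ ($k\ge k_0$), which is the same for all $i$. EBQ-CADMM: initialize $t_i=0$ for each agent $i$. Repeat the following: run BQ-CADMM (from zero initialization, with the fixed $\rho$) with the current data $r_i$ at agent $i$ until convergence or cycling is achieved, and denote its consensus value by $x_{BQ}$; if $|x_{BQ}|=L$, then each agent replaces $t_i$ by $t_i+\mathrm{sgn}(x_{BQ})L$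 and $r_i$ by $r_i-\mathrm{sgn}(x_{BQ})L$ and the loop continues; otherwise, stop. Return $t_i$ and the last $x_{BQ}$. In the claim, $\bar r$ is the average of the original data, before any replacement. Here $\mathrm{sgn}(x)=1$ if $x>0$ and $-1$ if $x<0$. *)

(* Defs.v *)
From HB Require Import structures.
From mathcomp Require Import all_boot all_order all_algebra.
From mathcomp Require Import reals.
From mathcomp Require Import lra.

Set Implicit Arguments.
Unset Strict Implicit.
Unset Printing Implicit Defensive.

Import Order.TTheory GRing.Theory Num.Theory.

Local Open Scope ring_scope.

(* A network on the nodes 0, ..., n-1 is given by its adjacency relation. *)
Definition connected_network (n : nat) (e : rel 'I_n) : Prop :=
  [/\ (0 < n)%N, symmetric e, irreflexive e & forall i j, connect e i j].

Definition neighbors (n : nat) (e : rel 'I_n) (i : 'I_n) : {set 'I_n} :=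
  [set j | e i j].

(* Each undirected edge {i, j} is counted once, as the pair (i, j), i < j. *)
Definition num_edges (n : nat) (e : rel 'I_n) : nat :=
  #|[set p : 'I_n * 'I_n | (p.1 < p.2)%N && e p.1 p.2]|.

(* Rounding to the nearest multiple of Delta, half-way points going down;
   see quantizerP. *)
Definition quantizer (R : realType) (Delta x : R) : R :=
  (Num.ceil (x / Delta - 1 / 2))%:~R * Delta.

Lemma quantizerP (R : realType) (Delta x : R) (t : int) : 0 < Delta ->
  (t%:~R - 1 / 2) * Delta < x <= (t%:~R + 1 / 2) * Delta ->
  quantizer Delta x = t%:~R * Delta.
Proof.
move=> D0 /andP[lo hi]; rewrite /quantizer; congr (_%:~R * _).
apply: Num.Theory.ceil_def; rewrite intrB.
move: lo hi; rewrite -ltr_pdivlMr // -ler_pdivrMr // => lo hi.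
by apply/andP; split; lra.
Qed.

(* The nearest-point projection of the real line onto [-L, L]. *)
Definition clip (R : realType) (L x : R) : R := Num.max (- L) (Num.min x L).

Definition bquantizer (R : realType) (Delta L x : R) : R :=
  quantizer Delta (clip L x).

(* One iteration of BQ-CADMM with data r on a state (x, alpha); alpha is
   updated with the new value of x. *)
Definition bq_cadmm_step (R : realType) (n : nat) (e : rel 'I_n)
    (Delta L rho : R) (r : 'I_n -> R) (s : ('I_n -> R) * ('I_n -> R)) :
    ('I_n -> R) * ('I_n -> R) :=
  let Qb := bquantizer Delta L in
  let deg i : R := #|neighbors e i|%:R in
  let x' i := 1 / (1 + 2 * rho * deg i) *
    (rho * deg i * Qb (s.1 i) + rho * (\sum_(j in neighbors e i) Qb (s.1 j))
     - s.2 i + r i) in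
  let alpha' i := s.2 i +
    rho * (deg i * Qb (x' i) - \sum_(j in neighbors e i) Qb (x' j)) in
  (x', alpha').

Definition bq_cadmm (R : realType) (n : nat) (e : rel 'I_n)
    (Delta L rho : R) (r : 'I_n -> R) (k : nat) :
    ('I_n -> R) * ('I_n -> R) :=
  iter k (bq_cadmm_step e Delta L rho r) (fun=> 0, fun=> 0).

Definition bq_x (R : realType) (n : nat) (e : rel 'I_n)
    (Delta L rho : R) (r : 'I_n -> R) (k : nat) : 'I_n -> R :=
  (bq_cadmm e Delta L rho r k).1.

Definition bq_converges (R : realType) (n : nat) (e : rel 'I_n)
    (Delta L rho : R) (r : 'I_n -> R) (v : R) : Prop :=
  exists k0 : nat, forall k, (k0 <= k)%N -> forall i,
    bquantizer Delta L (bq_x e Delta L rho r k i) = v.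

Definition bq_cycles (R : realType) (n : nat) (e : rel 'I_n)
    (Delta L rho : R) (r : 'I_n -> R) (v : R) : Prop :=
  exists k0 T : nat, (2 <= T)%N /\
    forall k, (k0 <= k)%N -> forall i,
      bq_x e Delta L rho r (k + T) i = bq_x e Delta L rho r k i /\
      v = T%:R^-1 *
          \sum_(1 <= l < T.+1) bquantizer Delta L (bq_x e Delta L rho r (k + l) i).

(* The run with data r reaches convergence or cycling, with consensus value
   v. There is at most one such v; see consensus_value_unique. *)
Definition consensus_value (R : realType) (n : nat) (e : rel 'I_n)
    (Delta L rho : R) (r : 'I_n -> R) (v : R) : Prop :=
  bq_converges e Delta L rho r v \/ bq_cycles e Delta L rho r v.

(* [ebq_cadmm e Delta L rho t r t' v] : the loop of EBQ-CADMM, entered with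
   the values t and the data r, stops after finitely many passes and returns
   t' and the consensus value v of its last BQ-CADMM run. *)
Inductive ebq_cadmm (R : realType) (n : nat) (e : rel 'I_n)
    (Delta L rho : R) (t r : 'I_n -> R) : ('I_n -> R) -> R -> Prop :=
| ebq_stop v :
    consensus_value e Delta L rho r v -> `|v| <> L ->
    ebq_cadmm e Delta L rho t r t v
| ebq_continue v t' v' :
    consensus_value e Delta L rho r v -> `|v| = L ->
    ebq_cadmm e Delta L rho
      (fun i => t i + Num.sg v * L) (fun i => r i - Num.sg v * L) t' v' ->
    ebq_cadmm e Delta L rho t r t' v'.

Definition Gamma0 (R : realType) (n : nat) (Delta L rho : R) : R :=
  Num.max (Delta / 2) (4 * rho * n%:R * L / (1 + 2 * rho * n%:R)).

Lemma consensus_value_window (R : realType) (n : nat) (e : rel 'I_n)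
    (Delta L rho : R) (r : 'I_n -> R) (v : R) :
  consensus_value e Delta L rho r v ->
  exists k0 T : nat, (0 < T)%N /\ forall k, (k0 <= k)%N -> forall i,
    \sum_(1 <= l < T.+1) bquantizer Delta L (bq_x e Delta L rho r (k + l) i)
    = T%:R * v.
Proof.
case=> [[k0 hv]|[k0 [T [T2 hv]]]].
  exists k0, 1%N; split=> // k hk i.
  by rewrite big_nat1 mul1r hv // (leq_trans hk) // leq_addr.
exists k0, T; split; first exact: ltnW.
move=> k hk i; have [_ ->] := hv k hk i.
by rewrite mulVKf // pnatr_eq0 -lt0n ltnW.
Qed.

Lemma sum_windows (R : realType) (f : nat -> R) (T k0 : nat) (v : R) :
  (forall k, (k0 <= k)%N -> \sum_(1 <= l < T.+1) f (k + l)%N = T%:R * v) ->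
  forall q, \sum_(1 <= l < (q * T).+1) f (k0 + l)%N = (q * T)%:R * v.
Proof.
move=> hf; elim=> [|q IH]; first by rewrite mul0n big_geq // mul0r.
rewrite (@big_cat_nat _ _ _ (q * T).+1) ?ltnS ?leq_mul2r ?leqnSn ?orbT //=.
rewrite IH mulSn addnC natrD mulrDl; congr (_ + _).
rewrite -(hf (k0 + q * T)%N) ?leq_addr // -[(q * T).+1]add1n big_addn.
rewrite subSn ?leq_addr // addKn; apply: eq_bigr => l _.
by rewrite -addnA [(l + _)%N]addnC.
Qed.

Lemma consensus_value_unique (R : realType) (n : nat) (e : rel 'I_n)
    (Delta L rho : R) (r : 'I_n -> R) (v v' : R) : (0 < n)%N ->
  consensus_value e Delta L rho r v -> consensus_value e Delta L rho r v' ->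
  v = v'.
Proof.
move=> n0 /consensus_value_window[k [T [T0 h]]].
move=> /consensus_value_window[k' [T' [T'0 h']]].
pose i : 'I_n := Ordinal n0; pose K := maxn k k'.
pose f l := bquantizer Delta L (bq_x e Delta L rho r l i).
have hK j : (K <= j)%N -> \sum_(1 <= l < T.+1) f (j + l)%N = T%:R * v.
  by move=> hj; apply: h; rewrite (leq_trans _ hj) // leq_maxl.
have hK' j : (K <= j)%N -> \sum_(1 <= l < T'.+1) f (j + l)%N = T'%:R * v'.
  by move=> hj; apply: h'; rewrite (leq_trans _ hj) // leq_maxr.
have := sum_windows hK' T; rewrite [(T * T')%N]mulnC (sum_windows hK T').
by move/mulfI; apply; rewrite pnatr_eq0 -lt0n muln_gt0 T0 T'0.
Qed.

Lemma ebq_cadmm_deterministic (R : realType) (n : nat) (e : rel 'I_n)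
    (Delta L rho : R) (t r t1 t2 : 'I_n -> R) (v1 v2 : R) : (0 < n)%N ->
  ebq_cadmm e Delta L rho t r t1 v1 -> ebq_cadmm e Delta L rho t r t2 v2 ->
  t1 = t2 /\ v1 = v2.
Proof.
move=> n0 run1; elim: run1 t2 v2 => {t r t1 v1}
  [t r v cv nL|t r v t1 v1 cv vL _ IH] t2 v2 run2.
- case: run2 => [w cw _|w t' w' cw wL _]; first by
    rewrite (consensus_value_unique n0 cv cw).
  by case: nL; rewrite (consensus_value_unique n0 cv cw).
- case: run2 => [w cw nL|w t' w' cw wL run2].
    by case: nL; rewrite -(consensus_value_unique n0 cv cw).
  by apply: IH; rewrite (consensus_value_unique n0 cv cw).
Qed.

(* Main.v *)
Require Import Defs.
From mathcomp Require Import all_boot all_order all_algebra.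
From mathcomp Require Import reals.
From mathcomp Require Import lra ring zify.

Set Implicit Arguments.
Unset Strict Implicit.
Unset Printing Implicit Defensive.

Import Order.TTheory GRing.Theory Num.Theory.

Local Open Scope ring_scope.

(** Write y_i^k for the quantized value of x_i^k, d_i for the degree of i, and
    C = (1 + 4 rho m / n) Delta / 2.

    A run of BQ-CADMM always has a consensus value.  The pair (y^k, alpha^k)
    determines the rest of the run; y^k and alpha^k / rho lie in Delta Z, and
    alpha^k is bounded, because a very large alpha_i pushes x_i below - L, and
    a node that outputs - L, the least possible value, cannot increase alpha_i
    any further ([braked_sequence_bounded]).  So some state recurs and the run
    is eventually periodic.  Over a period alpha does not change, so the sum of
    y over the period is harmonic on the graph, hence constant
    ([harmonic_const]): all nodes have the same period average.

    The alpha_i sum to zero, so summing the update of x over the nodes gives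
    sum_i (1 + 2 rho d_i) x_i^(k+1) = sum_i 2 rho d_i y_i^k + sum_i r_i.
    Averaged over a window on which every y_i has mean v, this says that
    n (rbar - v) is the sum of the terms (1 + 2 rho d_i) times the mean of
    x_i - y_i, so rbar - v <= C as soon as x <= y + Delta / 2.  That holds for
    an unsaturated node by rounding, but x_i could exceed L + Delta / 2 at a
    node which outputs L.  If v < L, no node outputs L forever, and since
    Gamma0 <= Delta / 2 each x_i moves by at most Delta / 2 in every step but
    the initial one; so a node reaches the ceiling with x_i <= L, and its later
    increments telescope to an overshoot of at most
    2 rho d_i Delta / (1 + 2 rho d_i) <= Delta / 2 ([ceiling_mean_error]).  The update of x and the quantizer enter this
    argument only through relations that are valid for - x as well, which gives
    v - rbar <= C when - L < v.

    Thus a pass of EBQ-CADMM that stops is C-accurate for its current data, and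
    a pass with v = L has rbar >= L - C >= 4 L / 5, so that subtracting L lowers
    |rbar| by at least 3 L / 5 ([saturated_mean_drop]); similarly for v = - L.
    Hence the loop ends. *)

(** * The bounded quantizer *)

Section Quantizer.
Variables (R : realType) (Delta L : R).
Hypotheses (Delta_gt0 : 0 < Delta) (L_gt0 : 0 < L).
Hypothesis (L_lattice : exists z : int, L = z%:~R * Delta).

Let Q := bquantizer Delta L.

Lemma clip_le (x : R) : clip L x <= L.
Proof. by rewrite /clip ge_max ge_min lexx orbT andbT; have := L_gt0; lra. Qed.

Lemma clip_ge (x : R) : - L <= clip L x.
Proof. by rewrite /clip le_max lexx. Qed.

Lemma ge_clip (x : R) : - L <= x -> clip L x <= x.
Proof. by move=> h; rewrite /clip ge_max h ge_min lexx. Qed.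

Lemma le_clip (x : R) : x <= L -> x <= clip L x.
Proof. by move=> h; rewrite /clip le_max le_min lexx h orbT. Qed.

Lemma clip_high (x : R) : L <= x -> clip L x = L.
Proof. by move=> h; rewrite /clip min_r // max_r //; have := L_gt0; lra. Qed.

Lemma clip_low (x : R) : x <= - L -> clip L x = - L.
Proof. by move=> h; rewrite /clip max_l // ge_min h. Qed.

Lemma clip_shift (x x' : R) : x' <= x + Delta -> clip L x' <= clip L x + Delta.
Proof.
move=> h; have D0 := Delta_gt0.
have [Lx|xL] := leP L x; first by rewrite (clip_high Lx); have := clip_le x'; lra.
have [x'L|Lx'] := leP x' (- L); first by rewrite (clip_low x'L); have := clip_ge x; lra.
by have := ge_clip (ltW Lx'); have := le_clip (ltW xL); lra.
Qed.

Lemma quantizer_error (x : R) :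
  quantizer Delta x - Delta / 2 <= x <= quantizer Delta x + Delta / 2.
Proof.
rewrite /quantizer; set t := Num.ceil _.
have := ceil_itv (x / Delta - 1 / 2); rewrite -/t intrB => /andP[lo hi].
have [lo' hi'] : t%:~R - 1 / 2 <= x / Delta /\ x / Delta <= t%:~R + 1 / 2 by lra.
rewrite ler_pdivlMr // in lo'; rewrite ler_pdivrMr // in hi'.
by apply/andP; split; lra.
Qed.

Lemma quantizer_shift (x x' : R) : x' <= x + Delta ->
  quantizer Delta x' <= quantizer Delta x + Delta.
Proof.
move=> h; rewrite /quantizer -[X in _ <= _ + X]mul1r -mulrDl ler_pM2r //.
rewrite -[1]/(1%:~R) -intrD ler_int ceil_le_int intrD.
have := ceil_ge (x / Delta - 1 / 2).
suff: x' / Delta <= x / Delta + 1 by lra.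
by rewrite ler_pdivrMr // mulrDl divfK ?gt_eqF // mul1r.
Qed.

Lemma quantizer_lattice (z : int) : quantizer Delta (z%:~R * Delta) = z%:~R * Delta.
Proof.
apply: quantizerP => //; rewrite ltr_pM2r // ler_pM2r //.
by apply/andP; split; lra.
Qed.

Lemma bquantizer_high (x : R) : L <= x -> Q x = L.
Proof.
by move=> h; rewrite /Q /bquantizer clip_high //; case: L_lattice => z ->;
   exact: quantizer_lattice.
Qed.

Lemma bquantizer_low (x : R) : x <= - L -> Q x = - L.
Proof.
move=> h; rewrite /Q /bquantizer clip_low //; case: L_lattice => z ->.
by rewrite -mulNr -intrN quantizer_lattice.
Qed.

Lemma quantizer_mono (x x' : R) : x <= x' -> quantizer Delta x <= quantizer Delta x'.
Proof.
move=> h; rewrite /quantizer ler_pM2r // ler_int le_ceil //.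
by rewrite lerB // ler_pM2r ?invr_gt0.
Qed.

Lemma bquantizer_le (x : R) : Q x <= L.
Proof.
by rewrite -[leRHS](bquantizer_high (lexx L)); apply: quantizer_mono;
   rewrite (clip_high (lexx _)) clip_le.
Qed.

Lemma bquantizer_ge (x : R) : - L <= Q x.
Proof.
by rewrite -[leLHS](bquantizer_low (lexx _)); apply: quantizer_mono;
   rewrite (clip_low (lexx _)) clip_ge.
Qed.

Lemma bquantizer_intr (x : R) : exists m : int, Q x = m%:~R * Delta.
Proof. by eexists. Qed.

Lemma bquantizer_upper_gap (x : R) : Q x < L -> Q x <= L - Delta.
Proof.
have [m ->] := bquantizer_intr x; have [z ->] := L_lattice.
rewrite ltr_pM2r // ltr_int -[X in _ <= _ - X]mul1r -mulrBl ler_pM2r //.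
by rewrite -[1]/(1%:~R) -intrB ler_int lerBrDr lezD1.
Qed.

Lemma bquantizer_lower_gap (x : R) : - L < Q x -> - L + Delta <= Q x.
Proof.
have [m ->] := bquantizer_intr x; have [z ->] := L_lattice.
rewrite -mulNr ltr_pM2r // -intrN ltr_int -[X in _ + X <= _]mul1r -mulrDl ler_pM2r //.
by rewrite -[1]/(1%:~R) -intrD ler_int lezD1.
Qed.

Lemma bquantizer_error_upper (x : R) : Q x < L -> x <= Q x + Delta / 2.
Proof.
move=> h; have xL : x <= L.
  by rewrite leNgt; apply/negP => /ltW /bquantizer_high hx; move: h; rewrite hx ltxx.
by have /andP[_] := quantizer_error (clip L x); apply: le_trans; exact: le_clip.
Qed.

Lemma bquantizer_error_lower (x : R) : - L < Q x -> Q x - Delta / 2 <= x.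
Proof.
move=> h; have xL : - L <= x.
  by rewrite leNgt; apply/negP => /ltW /bquantizer_low hx; move: h; rewrite hx ltxx.
have /andP[lo _] := quantizer_error (clip L x).
by apply: le_trans lo _; exact: ge_clip.
Qed.

Lemma bquantizer_step (x x' : R) : `|x' - x| <= Delta -> `|Q x' - Q x| <= Delta.
Proof.
rewrite !ler_norml => /andP[h1 h2].
have a : Q x' <= Q x + Delta.
  by apply: quantizer_shift; apply: clip_shift; lra.
have b : Q x <= Q x' + Delta.
  by apply: quantizer_shift; apply: clip_shift; lra.
by apply/andP; split; lra.
Qed.

End Quantizer.

(** * Sums over neighbourhoods and harmonic functions *)

Section Graph.
Variables (R : realType) (n : nat) (e : rel 'I_n).
Hypotheses (e_sym : symmetric e) (e_irr : irreflexive e).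

(** Handshake lemma: the ordered adjacent pairs (i, j) split into those with
    i < j, which are the edges, and their mirror images. *)
Lemma sum_card_neighbors :
  (\sum_(i < n) #|neighbors e i| = (num_edges e).*2)%N.
Proof.
pose half (i j : 'I_n) : nat := ((i < j)%N && e i j).
have -> : num_edges e = (\sum_i \sum_j half i j)%N.
  rewrite /num_edges -sum1_card pair_big big_mkcond /=.
  by apply: eq_bigr => -[i j] _; rewrite inE /half /=; case: (_ && _).
rewrite -addnn [X in (_ + X)%N]exchange_big -big_split /=.
apply: eq_bigr => i _; rewrite -sum1_card -big_split big_mkcond /=.
apply: eq_bigr => j _; rewrite inE /half [e j i]e_sym.
case: (ltngtP i j) => [||/val_inj ->]; rewrite ?e_irr //=; by case: (e i j).
Qed.

Lemma sum_deg :
  \sum_(i < n) #|neighbors e i|%:R = 2 * (num_edges e)%:R :> R.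
Proof. by rewrite -natr_sum sum_card_neighbors -mul2n natrM. Qed.

Lemma sum_sum_neighbors (w : 'I_n -> R) :
  \sum_i \sum_(j in neighbors e i) w j = \sum_i #|neighbors e i|%:R * w i.
Proof.
rewrite (exchange_big_dep xpredT) //=; apply: eq_bigr => j _.
rewrite sumr_const mulr_natl; congr (_ *+ _).
apply: eq_card => i; rewrite [in RHS]inE -e_sym; exact: (in_set (e i) j).
Qed.

(** The maximum principle: a neighbour of a node where a harmonic function
    is maximal is again such a node, and every node is reachable. *)
Lemma harmonic_const (w : 'I_n -> R) : (forall i j, connect e i j) ->
  (forall i, #|neighbors e i|%:R * w i = \sum_(j in neighbors e i) w j) ->
  forall i j, w i = w j.
Proof.
move=> conn harm i j.
pose m := [arg max_(k > i) w k]%O.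
have max_m k : w k <= w m by rewrite /m; case: arg_maxP => // m' _; exact.
suff top k : w k = w m by rewrite !top.
have /connectP[p] := conn m k; elim/last_ind: p k => [k _ -> //|p l IH k].
rewrite rcons_path last_rcons => /andP[mp el] ->.
have wl := IH _ mp erefl.
have sum0 : \sum_(h in neighbors e (last m p)) (w m - w h) = 0.
  by rewrite sumrB sumr_const -wl -harm mulr_natl subrr.
apply/esym/eqP; rewrite -subr_eq0; apply/eqP.
by apply: (psumr_eq0P _ sum0) => [h _|]; rewrite ?subr_ge0 // inE.
Qed.

End Graph.

(** * Eventual periodicity *)

Lemma pigeonhole_nat (T : finType) (f : nat -> T) :
  exists a b, (a < b)%N /\ f a = f b.
Proof.
pose g (i : 'I_#|T|.+1) := f i.
have /injectivePn[a [b neq eqg]] : ~~ injectiveb g.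
  by apply/negP => /injectiveP/leq_card; rewrite card_ord ltnn.
by case: (ltngtP a b) neq => [lt _|lt _|/val_inj -> /[!eqxx] //];
  [exists a, b | exists b, a].
Qed.

(** A bounded family of points of a lattice takes finitely many values, which
    are encoded here as integers in [- N, N] shifted by N. *)
Lemma bounded_lattice_recurs (R : realType) (I : finType) (c : R)
    (u : nat -> I -> R) (B : I -> R) : 0 < c ->
  (forall k i, exists m : int, u k i = m%:~R * c) ->
  (forall k i, `|u k i| <= B i) ->
  exists a b, (a < b)%N /\ forall i, u a i = u b i.
Proof.
move=> c0 lat bnd.
pose N := (\max_i absz (Num.ceil (B i / c)))%N.
pose code k : {ffun I -> 'I_(2 * N).+1} :=
  [ffun i => inord (absz (Num.floor (u k i / c) + N%:Z))].
have [a [b [ab /ffunP eqc]]] := pigeonhole_nat code.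
exists a, b; split=> // i; have := eqc i; rewrite !ffunE.
have range k : exists m : int, [/\ u k i = m%:~R * c,
    Num.floor (u k i / c) = m & `|m| <= N%:Z].
  have [m um] := lat k i; exists m; split=> //.
    by rewrite um mulfK ?gt_eqF // intrKfloor.
  have le_m : `|m| <= Num.ceil (B i / c).
    rewrite -(ler_int R); apply: le_trans (ceil_ge _).
    rewrite ler_pdivlMr // -[c]gtr0_norm // intr_norm -normrM -um.
    exact: bnd.
  apply: (le_trans le_m); apply: (@le_trans _ _ `|Num.ceil (B i / c)|).
    exact: ler_norm.
  by rewrite -abszE lez_nat /N (leq_bigmax i).
have [ma [-> -> ha]] := range a; have [mb [-> -> hb]] := range b.
move/(congr1 val); rewrite /= !inordK; [|lia..].
by move=> eqn; have -> : ma = mb by lia.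
Qed.

(** Above the threshold tau the sequence cannot grow, so it exceeds tau by at
    most the one step that crosses it. *)
Lemma braked_sequence_bounded (R : realType) (a : nat -> R) (tau s : R) :
  a 0%N = 0 -> (forall k, a k.+1 <= a k + s) ->
  (forall k, tau <= a k -> a k.+1 <= a k) ->
  forall k, a k <= `|tau| + `|s|.
Proof.
move=> a0 step brake; elim=> [|k IH]; first by rewrite a0 addr_ge0.
have [/brake|lt] := leP tau (a k); first by move/le_trans; apply.
apply: (le_trans (step k)); apply: lerD; last exact: ler_norm.
by apply: (le_trans (ltW lt)); exact: ler_norm.
Qed.

(** * The mean error of a run that does not stay at the ceiling *)

(** What the upper half of the error analysis needs to know about a run.  All
    these relations also hold for the opposite of a BQ-CADMM run, with the
    opposite data, so both halves follow from the same lemma.  Time is shifted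
    by one, because the initial x is not produced by the update rule and the
    first increment of x can be large. *)
Record ceiling_run (R : realType) (n : nat) (e : rel 'I_n)
    (Delta L rho : R) (r : 'I_n -> R) (X Y : nat -> 'I_n -> R) : Prop :=
  CeilingRun {
    ceiling_le : forall k i, Y k i <= L;
    ceiling_gap : forall k i, Y k i < L -> Y k i <= L - Delta;
    ceiling_error : forall k i, Y k i < L -> X k i <= Y k i + Delta / 2;
    ceiling_stepX : forall k i, X k.+1 i <= X k i + Delta / 2;
    ceiling_stepY : forall k i, Y k.+1 i <= Y k i + Delta;
    ceiling_rec : forall k i,
      (1 + 2 * rho * #|neighbors e i|%:R) * (X k.+2 i - X k.+1 i) =
      rho * \sum_(j in neighbors e i) (2 * Y k.+1 j - Y k j - Y k i);
    ceiling_mean : forall k,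
      \sum_i (1 + 2 * rho * #|neighbors e i|%:R) * X k.+1 i =
      \sum_i 2 * rho * #|neighbors e i|%:R * Y k i + \sum_i r i }.

Section CeilingRun.
Variables (R : realType) (n : nat) (e : rel 'I_n).
Variables (Delta L rho : R) (r : 'I_n -> R) (X Y : nat -> 'I_n -> R).
Hypotheses (Delta_gt0 : 0 < Delta) (rho_gt0 : 0 < rho).
Hypothesis run : ceiling_run e Delta L rho r X Y.
Hypothesis small_deg :
  forall i, 4 * rho * #|neighbors e i|%:R <= 1 + 2 * rho * #|neighbors e i|%:R.

Let c i : R := 1 + 2 * rho * #|neighbors e i|%:R.

Let c_gt0 i : 0 < c i.
Proof. by rewrite ltr_wpDr // !mulr_ge0 // ltW. Qed.

(* Steps of size Delta / 2 cannot jump over the half cell below the ceiling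
   [L - Delta / 2, L]. *)
Let entry k i : Y k i < L -> X k.+1 i <= L.
Proof.
move=> lt; have := ceiling_gap run lt; have := ceiling_error run lt.
by have := ceiling_stepX run k i; lra.
Qed.

(* Bounding Y by L in the invariant below leaves 2 rho d Delta, and the overshoot
   is at most Delta / 2 because the degree is small. *)
Let overshoot k i :
  c i * (X k.+1 i - L) <= rho * \sum_(j in neighbors e i) (Y k j - L + 2 * Delta) ->
  X k.+1 i <= L + Delta / 2.
Proof.
move=> /le_trans h.
have {h} : c i * (X k.+1 i - L) <= rho * \sum_(j in neighbors e i) (2 * Delta).
  apply: h; rewrite ler_pM2l //; apply: ler_sum => j _.
  by have := ceiling_le run k j; lra.
rewrite sumr_const -mulr_natl => h.
have : c i * (X k.+1 i - L) <= c i * (Delta / 2).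
  apply: (le_trans h); have := ler_wpM2r (ltW Delta_gt0) (small_deg i).
  by rewrite /c; lra.
by rewrite ler_pM2l //; lra.
Qed.

(* While node i stays at the ceiling, the increments of X i are, up to a
   positive factor, sums over the neighbours j of
   (Y k.+1 j - Y k j) + (Y k.+1 j - L).  The first part telescopes and the second
   is nonpositive.  The term 2 * Delta pays for the step of entry:
   Y k j and Y k i may each be Delta below their next values. *)
Let invariant a i : Y a i < L -> forall k, (a <= k)%N ->
  Y k i < L \/
  c i * (X k.+1 i - L) <= rho * \sum_(j in neighbors e i) (Y k j - L + 2 * Delta).
Proof.
move=> ya k /subnKC <-; elim: (k - a)%N => [|d]; first by left; rewrite addn0.
rewrite addnS; set l := (a + d)%N => IH.
have := ceiling_le run l.+1 i; rewrite le_eqVlt => /orP[/eqP full|]; last by left.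
right; have rec := ceiling_rec run l i.
have -> : c i * (X l.+2 i - L) = c i * (X l.+1 i - L) + c i * (X l.+2 i - X l.+1 i).
  by ring.
rewrite {2}/c rec.
have := ceiling_le run l i; rewrite le_eqVlt => /orP[/eqP full'|lt].
- case: IH => [|IH]; first by rewrite full' ltxx.
  apply: (le_trans (lerD IH (lexx _))); rewrite -mulrDr -big_split /=.
  rewrite ler_pM2l //; apply: ler_sum => j _; rewrite full'.
  by have := ceiling_le run l.+1 j; lra.
- have le0 : c i * (X l.+1 i - L) <= 0.
    by rewrite pmulr_rle0 // subr_le0 entry.
  apply: (le_trans (lerD le0 (lexx _))); rewrite add0r ler_pM2l //.
  apply: ler_sum => j _; have := ceiling_stepY run l j.
  by have := ceiling_stepY run l i; rewrite full; lra.
Qed.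

Let error_after a i : Y a i < L ->
  forall k, (a <= k)%N -> X k i <= Y k i + Delta / 2.
Proof.
move=> ya k ak; have := ceiling_le run k i; rewrite le_eqVlt.
case/orP=> [/eqP full|]; last exact: (ceiling_error run).
rewrite full; case: k ak full => [|k] ak full.
  by move: ak ya; rewrite leqn0 => /eqP ->; rewrite full ltxx.
have ak' : (a <= k)%N.
  by move: ak; rewrite leq_eqVlt ltnS => /orP[/eqP ak|//]; move: ya; rewrite ak full ltxx.
have := ceiling_le run k i; rewrite le_eqVlt => /orP[/eqP full'|lt].
  apply: overshoot; case: (invariant ya ak') => //.
  by rewrite full' ltxx.
by have := entry lt; have D0 := Delta_gt0; lra.
Qed.

(** If the window means are v < L, every node leaves the ceiling at some time in
    every window, after which X <= Y + Delta / 2 forever.  Summing the mean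
    identity over a window then bounds the mean of r. *)
Lemma ceiling_mean_error (v : R) (k0 T : nat) : (0 < T)%N -> v < L ->
  (forall k, (k0 <= k)%N -> forall i, \sum_(1 <= l < T.+1) Y (k + l)%N i = T%:R * v) ->
  \sum_i (r i - v) <= \sum_i c i * (Delta / 2).
Proof.
move=> T0 vL win; have T0' : 0 < T%:R :> R by rewrite ltr0n.
pose K := (k0 + T)%N; have k0K : (k0 <= K)%N by rewrite leq_addr.
have err k i : (K <= k)%N -> X k i <= Y k i + Delta / 2.
  move=> Kk.
  pose below l := Y (k0 + l)%N i < L.
  have [/hasP[l]|/hasPn high] := boolP (has below (index_iota 1 T.+1)).
    rewrite mem_index_iota => /andP[_ lT] yl; apply: (error_after yl).
    by apply: leq_trans Kk; rewrite leq_add2l -ltnS.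
  have : T%:R * L <= T%:R * v.
    have -> : T%:R * L = \sum_(1 <= l < T.+1) L.
      by rewrite sumr_const_nat subn1 mulr_natl.
    rewrite -(win k0 _ i) //; apply: ler_sum_nat => l lT.
    by rewrite leNgt; apply: high; rewrite mem_index_iota.
  by rewrite ler_pM2l // leNgt vL.
have : T%:R * (\sum_i (2 * rho * #|neighbors e i|%:R * v) + \sum_i r i) <=
       T%:R * \sum_i c i * (v + Delta / 2).
  have -> : T%:R * (\sum_i (2 * rho * #|neighbors e i|%:R * v) + \sum_i r i) =
            \sum_(1 <= l < T.+1) \sum_i c i * X (K + l).+1 i.
    under [RHS]eq_bigr => l _ do rewrite (ceiling_mean run).
    rewrite big_split /= sumr_const_nat subn1 mulrDr; congr (_ + _); last by rewrite mulr_natl.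
    rewrite exchange_big mulr_sumr; apply: eq_bigr => i _ /=.
    by rewrite -mulr_sumr win // mulrCA.
  have -> : T%:R * (\sum_i c i * (v + Delta / 2)) =
            \sum_(1 <= l < T.+1) \sum_i c i * (Y (K.+1 + l)%N i + Delta / 2).
    rewrite exchange_big mulr_sumr; apply: eq_bigr => i _ /=.
    rewrite -mulr_sumr big_split /= win ?leqW // sumr_const_nat subn1.
    by rewrite mulrCA mulrDr [T%:R * (_ / _)]mulr_natl.
  apply: ler_sum => l _; apply: ler_sum => i _; rewrite ler_pM2l // addSn.
  by apply: err; rewrite leqW // leq_addr.
rewrite ler_pM2l // -big_split /= => le.
rewrite -subr_ge0 -sumrB; move: le; rewrite -subr_ge0 -sumrB.
by congr (_ <= _); apply: eq_bigr => i _; rewrite /c; ring.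
Qed.

End CeilingRun.

(** * BQ-CADMM *)

Section Run.
Variables (R : realType) (n : nat) (e : rel 'I_n) (Delta L rho : R).
Hypothesis He : connected_network e.
Hypotheses (Delta_gt0 : 0 < Delta) (L_gt0 : 0 < L) (rho_gt0 : 0 < rho).
Hypothesis L_lattice : exists z : int, L = z%:~R * Delta.
Variable r : 'I_n -> R.

Let n_gt0 : (0 < n)%N. Proof. by case: He. Qed.
Let e_sym : symmetric e. Proof. by case: He. Qed.
Let e_irr : irreflexive e. Proof. by case: He. Qed.

Let d i : R := #|neighbors e i|%:R.
Let x := bq_x e Delta L rho r.
Let alpha k := (bq_cadmm e Delta L rho r k).2.
Let y k i := bquantizer Delta L (x k i).

Let d_ge0 i : 0 <= d i. Proof. exact: ler0n. Qed.

Let c_gt0 i : 0 < 1 + 2 * rho * d i.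
Proof. by rewrite ltr_wpDr // !mulr_ge0 // ltW. Qed.

Let x_rec k i : (1 + 2 * rho * d i) * x k.+1 i =
  rho * d i * y k i + rho * (\sum_(j in neighbors e i) y k j) - alpha k i + r i.
Proof.
rewrite /x /bq_x /bq_cadmm iterS /= div1r mulVKf // lt0r_neq0 // c_gt0.
Qed.

Let alpha_rec k i : alpha k.+1 i =
  alpha k i + rho * (d i * y k.+1 i - \sum_(j in neighbors e i) y k.+1 j).
Proof. by []. Qed.

Let sum_alpha k : \sum_i alpha k i = 0.
Proof.
elim: k => [|k IH]; first by rewrite big1.
under eq_bigr => i _ do rewrite alpha_rec.
rewrite big_split /= IH add0r -mulr_sumr sumrB.
by rewrite sum_sum_neighbors // subrr mulr0.
Qed.

(** The difference of two consecutive updates of x no longer contains the data,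
    and alpha enters it only through its own increment. *)
Lemma bq_x_step k i :
  (1 + 2 * rho * d i) * (x k.+2 i - x k.+1 i) =
  rho * \sum_(j in neighbors e i) (2 * y k.+1 j - y k j - y k i).
Proof.
rewrite mulrBr !x_rec alpha_rec !sumrB -mulr_sumr sumr_const -mulr_natl -/(d i).
by ring.
Qed.

(** The multipliers alpha always sum to zero, hence disappear from the sum of
    the updates over the nodes. *)
Lemma bq_x_mean k :
  \sum_i (1 + 2 * rho * d i) * x k.+1 i =
  \sum_i 2 * rho * d i * y k i + \sum_i r i.
Proof.
under eq_bigr => i _ do rewrite x_rec.
rewrite big_split sumrB sum_alpha subr0 big_split /=; congr (_ + _).
rewrite -[X in _ + X]mulr_sumr sum_sum_neighbors // mulr_sumr -big_split /=.
by apply: eq_bigr => i _; rewrite -/(d i); ring.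
Qed.

Let y_le k i : y k i <= L. Proof. exact: bquantizer_le. Qed.
Let y_ge k i : - L <= y k i. Proof. exact: bquantizer_ge. Qed.

Let sum_y_le k i : \sum_(j in neighbors e i) y k j <= d i * L.
Proof. by rewrite mulr_natl -sumr_const; apply: ler_sum. Qed.

Let sum_y_ge k i : d i * - L <= \sum_(j in neighbors e i) y k j.
Proof. by rewrite mulr_natl -sumr_const; apply: ler_sum. Qed.

Let alpha_lattice k i : exists m : int, alpha k i / rho = m%:~R * Delta.
Proof.
elim: k => [|k [m IH]]; first by exists 0; rewrite mul0r mul0r.
pose q j := Num.ceil (clip L (x k.+1 j) / Delta - 1 / 2).
exists (m + (#|neighbors e i|%:Z * q i - \sum_(j in neighbors e i) q j)).
rewrite alpha_rec mulrDl IH mulrAC divff ?gt_eqF // mul1r intrD intrB intrM.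
rewrite rmorph_sum /= !mulrDl mulNr mulr_suml mulrA.
by congr (_ + (_ - _)).
Qed.

(* When alpha i is large, x i falls below - L and its output is the least
   possible one, which makes the increment of alpha i nonpositive; similarly for
   - alpha i.  The value s i bounds one increment. *)
Let alpha_bounded : exists B : 'I_n -> R, forall k i, `|alpha k i| <= B i.
Proof.
pose s i := rho * (2 * d i * L).
exists (fun i => (`|r i + s i + (1 + 2 * rho * d i) * L| +
                  `|- r i + s i + (1 + 2 * rho * d i) * L|) + (`|s i| + `|s i|)).
move=> k i.
have rd : 0 <= rho * d i by rewrite mulr_ge0 // ltW.
have scale a b : a <= b -> rho * d i * a <= rho * d i * b.
  by move=> ab; rewrite ler_wpM2l.
have s_le a : d i * (- L) <= a -> rho * (d i * (- L)) <= rho * a.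
  by rewrite ler_pM2l.
have s_ge a : a <= d i * L -> rho * a <= rho * (d i * L).
  by rewrite ler_pM2l.
have stepN l : alpha l.+1 i - alpha l i =
    rho * d i * y l.+1 i - rho * \sum_(j in neighbors e i) y l.+1 j.
  by rewrite alpha_rec; ring.
have up : alpha k i <= `|r i + s i + (1 + 2 * rho * d i) * L| + `|s i|.
  apply: (@braked_sequence_bounded _ (alpha^~ i)) => // l.
    have := stepN l; have := scale _ _ (y_le l.+1 i); have := s_le _ (sum_y_ge l.+1 i).
    by rewrite /s; lra.
  move=> big; have sat : y l.+1 i = - L.
    apply: bquantizer_low => //; rewrite -(ler_pM2l (c_gt0 i)) x_rec.
    have := scale _ _ (y_le l i); have := s_ge _ (sum_y_le l i).
    by move: big; rewrite /s; lra.
  have := stepN l; rewrite sat; have := s_le _ (sum_y_ge l.+1 i); lra.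
have down : - alpha k i <= `|- r i + s i + (1 + 2 * rho * d i) * L| + `|s i|.
  apply: (@braked_sequence_bounded _ (fun k => - alpha k i)) => [|l|l].
  - exact: oppr0.
  - have := stepN l; have := scale _ _ (y_ge l.+1 i); have := s_ge _ (sum_y_le l.+1 i).
    by rewrite /s; lra.
  move=> big; have sat : y l.+1 i = L.
    apply: bquantizer_high => //; rewrite -(ler_pM2l (c_gt0 i)) x_rec.
    have := scale _ _ (y_ge l i); have := s_le _ (sum_y_ge l i).
    by move: big; rewrite /s; lra.
  have := stepN l; rewrite sat; have := s_ge _ (sum_y_le l.+1 i); lra.
have n1 := normr_ge0 (r i + s i + (1 + 2 * rho * d i) * L).
have n2 := normr_ge0 (- r i + s i + (1 + 2 * rho * d i) * L).
have n3 := normr_ge0 (s i).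
by rewrite ler_norml; apply/andP; split; lra.
Qed.

(* The pair (y, alpha), rather than x, is the state to follow: it is discrete
   and determines the next x. *)
Let state_recurs : exists a b, (a < b)%N /\
  forall i, y a i = y b i /\ alpha a i = alpha b i.
Proof.
have [B hB] := alpha_bounded.
pose u k (p : 'I_n * bool) := if p.2 then y k p.1 else alpha k p.1 / rho.
have [||a [b [ab eqs]]] := @bounded_lattice_recurs R _ Delta u
    (fun p => if p.2 then L else B p.1 / rho) Delta_gt0.
- by move=> k [i []]; [exact: bquantizer_intr | exact: alpha_lattice].
- move=> k [i []]; rewrite /u /=.
    by rewrite ler_norml y_le y_ge.
  by rewrite normrM normfV (gtr0_norm rho_gt0) ler_pM2r ?invr_gt0.
exists a, b; split=> // i; split; first exact: (eqs (i, true)).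
by apply: (mulIf _ (eqs (i, false))); rewrite invr_eq0 gt_eqF.
Qed.

Let state_next a b :
  (forall i, y a i = y b i /\ alpha a i = alpha b i) ->
  forall i, x a.+1 i = x b.+1 i /\ alpha a.+1 i = alpha b.+1 i.
Proof.
move=> eqs.
have eqx i : x a.+1 i = x b.+1 i.
  apply: (mulfI (lt0r_neq0 (c_gt0 i))); rewrite !x_rec.
  have [-> ->] := eqs i; congr (_ + _ * _ - _ + _).
  by apply: eq_bigr => j _; have [->] := eqs j.
move=> i; split=> //; rewrite !alpha_rec; have [_ ->] := eqs i.
rewrite /y eqx; congr (_ + _ * (_ - _)).
by apply: eq_bigr => j _; rewrite eqx.
Qed.

Let eventually_periodic : exists k0 T, (0 < T)%N /\
  forall k, (k0 <= k)%N -> forall i,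
    x (k + T)%N i = x k i /\ alpha (k + T)%N i = alpha k i.
Proof.
have [a [b [ab eqs]]] := state_recurs.
exists a.+1, (b - a)%N; split; first by rewrite subn_gt0.
move=> k /subnKC <-; elim: (k - a.+1)%N => [|l IH] i.
  rewrite addn0 addSn subnKC; last exact: ltnW.
  by have [-> ->] := state_next eqs i.
rewrite addnS addSn; apply: state_next => {}i.
by have [h ->] := IH i; rewrite /y h.
Qed.

(** The double of a period is used, since a period of a cycle must be at least
    2.  A constant run thus counts as a cycle, with the same consensus value. *)
Lemma consensus_value_exists : exists v, consensus_value e Delta L rho r v.
Proof.
have [k0 [T [T0 per]]] := eventually_periodic.
have per2 k : (k0 <= k)%N -> forall i,
    x (k + (T + T))%N i = x k i /\ alpha (k + (T + T))%N i = alpha k i.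
  move=> k0k i; rewrite addnA; have [h1 h2] := per k k0k i.
  by have [-> ->] := per _ (leq_trans k0k (leq_addr T k)) i.
set P := (T + T)%N in per2.
have P2 : (2 <= P)%N by rewrite /P; lia.
pose w k i := \sum_(1 <= l < P.+1) y (k + l)%N i.
have w_const k : (k0 <= k)%N -> forall i j, w k i = w k j.
  (* rho times the defect of harmonicity is the change of alpha over a period. *)
  move=> k0k; case: (He) => _ _ _ conn; apply: harmonic_const conn _ => i.
  rewrite /w exchange_big /= mulr_sumr -/(d i); apply/eqP; rewrite -subr_eq0 -sumrB.
  apply/eqP/(mulfI (lt0r_neq0 rho_gt0)); rewrite mulr0 mulr_sumr.
  transitivity (alpha (k + P)%N i - alpha (k + 0)%N i); last first.
    by rewrite addn0; have [_ ->] := per2 k k0k i; rewrite subrr.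
  rewrite -(@telescope_sumr _ 0 P (fun l => alpha (k + l)%N i)) //.
  rewrite big_add1 /=. apply: eq_bigr => l _.
  by rewrite addnS alpha_rec; ring.
have w_stable k : (k0 <= k)%N -> forall i, w k i = w k0 i.
  move=> /subnKC <- i; elim: (k - k0)%N => [|l IH]; first by rewrite addn0.
  rewrite -IH addnS; apply/eqP; rewrite -subr_eq0 /w -sumrB.
  under eq_bigr => m _ do rewrite addSn -addnS.
  rewrite (telescope_sumr (fun m => y (k0 + l + m)%N i)) //.
  rewrite -addSnnS addn1 /y; have [->] := per2 (k0 + l).+1 (leqW (leq_addr _ _)) i.
  by rewrite subrr.
pose i0 : 'I_n := Ordinal n_gt0.
exists (P%:R^-1 * w k0 i0); right; exists k0, P; split=> // k k0k i.
split; first by have [] := per2 k k0k i.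
by congr (_ * _); rewrite -(w_stable k k0k); exact: w_const.
Qed.

End Run.

(** * Accuracy of one run and termination of EBQ-CADMM *)

Section Accuracy.
Variables (R : realType) (n : nat) (e : rel 'I_n) (Delta L rho : R).
Hypothesis He : connected_network e.
Hypotheses (Delta_gt0 : 0 < Delta) (L_gt0 : 0 < L) (rho_gt0 : 0 < rho).
Hypothesis L_lattice : exists z : int, L = z%:~R * Delta.
Hypothesis Gamma0_le : Gamma0 n Delta L rho <= Delta / 2.

Let n_gt0 : 0 < n%:R :> R. Proof. by case: He => n0 *; rewrite ltr0n. Qed.

Let Delta_le_L : Delta <= L.
Proof.
have [z Lz] := L_lattice; move: L_gt0; rewrite Lz pmulr_lgt0 // ltr0z => z0.
by rewrite ler_peMl ?(ltW Delta_gt0) // -[1]/(1%:~R) ler_int; lia.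
Qed.

Definition error_bound : R := (1 + 4 * rho * ((num_edges e)%:R / n%:R)) * (Delta / 2).

Lemma sum_error_bound :
  \sum_i (1 + 2 * rho * #|neighbors e i|%:R) * (Delta / 2) = n%:R * error_bound.
Proof.
case: He => _ sym irr _; rewrite -mulr_suml big_split /= -mulr_sumr.
rewrite sum_deg // sumr_const card_ord /error_bound; field.
by rewrite gt_eqF.
Qed.

(** The bound on Gamma0 gives this inequality with n in place of the degree; it
    is equivalent to rho n (8 L - 2 Delta) <= Delta, so it is inherited by smaller
    values than n because Delta <= L. *)
Lemma step_bound i :
  8 * rho * #|neighbors e i|%:R * L <= (1 + 2 * rho * #|neighbors e i|%:R) * Delta.
Proof.
have : #|neighbors e i|%:R <= n%:R :> R.
  by rewrite ler_nat -[X in (_ <= X)%N]card_ord max_card.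
move: #|neighbors e i|%:R => d dn.
have := Gamma0_le; rewrite /Gamma0 ge_max => /andP[_].
have c0 : 0 < 1 + 2 * rho * n%:R by rewrite ltr_wpDr // !mulr_ge0 // ltW.
rewrite ler_pdivrMr // => h.
have pos : 0 <= rho * (8 * L - 2 * Delta).
  by rewrite mulr_ge0 ?(ltW rho_gt0) //; have := Delta_le_L; have := L_gt0; lra.
by have := ler_wpM2r pos dn; lra.
Qed.

Lemma small_step i :
  4 * rho * #|neighbors e i|%:R <= 1 + 2 * rho * #|neighbors e i|%:R.
Proof.
rewrite -(ler_pM2r Delta_gt0); apply: le_trans (step_bound i).
have rd : 0 <= rho * #|neighbors e i|%:R by rewrite mulr_ge0 // ltW.
have := ler_wpM2l rd Delta_le_L; have := mulr_ge0 rd (ltW L_gt0).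
lra.
Qed.

Section OneRun.
Variable r : 'I_n -> R.
Let x := bq_x e Delta L rho r.
Let y k i := bquantizer Delta L (x k i).

(** Each neighbour contributes at most 4 rho L to the increment of
    (1 + 2 rho d_i) x_i, and [step_bound] compares the total with Delta / 2. *)
Lemma bq_x_slow k i : `|x k.+2 i - x k.+1 i| <= Delta / 2.
Proof.
have c0 : 0 < 1 + 2 * rho * #|neighbors e i|%:R.
  by rewrite ltr_wpDr // !mulr_ge0 // ltW.
rewrite -(ler_pM2l c0) -{1}(gtr0_norm c0) -normrM bq_x_step //.
have sum_bound : `|\sum_(j in neighbors e i) (2 * y k.+1 j - y k j - y k i)| <=
    #|neighbors e i|%:R * (4 * L).
  rewrite mulr_natl -sumr_const; apply: (le_trans (ler_norm_sum _ _ _)).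
  have yb l j : - L <= y l j <= L.
    by rewrite /y bquantizer_ge // bquantizer_le.
  apply: ler_sum => j _; have := yb k.+1 j; have := yb k j; have := yb k i.
  by move=> /andP[? ?] /andP[? ?] /andP[? ?]; rewrite ler_norml; apply/andP; split; lra.
rewrite normrM (gtr0_norm rho_gt0).
have := ler_wpM2l (ltW rho_gt0) sum_bound; have := step_bound i.
by rewrite /y /x; lra.
Qed.

Let step_hi k i : x k.+2 i <= x k.+1 i + Delta / 2.
Proof. by have := bq_x_slow k i; rewrite ler_norml => /andP[_]; lra. Qed.

Let step_lo k i : x k.+1 i <= x k.+2 i + Delta / 2.
Proof. by have := bq_x_slow k i; rewrite ler_norml => /andP[]; lra. Qed.

Let y_slow k i : - Delta <= y k.+2 i - y k.+1 i <= Delta.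
Proof.
rewrite -ler_norml; apply: bquantizer_step => //.
by apply: (le_trans (bq_x_slow k i)); have := Delta_gt0; lra.
Qed.

Lemma bq_ceiling_run :
  ceiling_run e Delta L rho r (fun k => x k.+1) (fun k => y k.+1).
Proof.
split=> [k i|k i|k i|k i|k i|k i|k].
- exact: bquantizer_le.
- exact: bquantizer_upper_gap.
- exact: bquantizer_error_upper.
- exact: step_hi.
- by have /andP[_] := y_slow k i; lra.
- exact: bq_x_step.
- exact: bq_x_mean.
Qed.

Lemma bq_floor_run :
  ceiling_run e Delta L rho (fun i => - r i)
    (fun k i => - x k.+1 i) (fun k i => - y k.+1 i).
Proof.
split=> [k i|k i|k i|k i|k i|k i|k].
- by rewrite lerNl bquantizer_ge.
- rewrite ltrNl => /(bquantizer_lower_gap Delta_gt0 L_lattice).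
  by rewrite -/(y k.+1 i); lra.
- rewrite ltrNl => /(bquantizer_error_lower Delta_gt0 L_lattice).
  by rewrite -/(y k.+1 i); lra.
- by have := step_lo k i; lra.
- by have /andP[] := y_slow k i; lra.
- rewrite -opprD mulrN bq_x_step // -mulrN -sumrN; congr (_ * _).
  by apply: eq_bigr => j _; rewrite /y /x; ring.
- under eq_bigr => i _ do rewrite mulrN.
  rewrite sumrN bq_x_mean // opprD -!sumrN; congr (_ + _).
  by apply: eq_bigr => i _; rewrite mulrN.
Qed.

Let rbar := n%:R^-1 * \sum_i r i.

Let sum_dev v : \sum_i (r i - v) = n%:R * (rbar - v).
Proof.
rewrite sumrB sumr_const card_ord /rbar mulrBr mulVKf ?gt_eqF // mulr_natl.
by [].
Qed.

Lemma consensus_value_lower v : consensus_value e Delta L rho r v -> v < L ->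
  rbar - v <= error_bound.
Proof.
move=> /consensus_value_window[k0 [T [T0 win]]] vL.
rewrite -(ler_pM2l n_gt0) -sum_dev -sum_error_bound.
apply: (ceiling_mean_error Delta_gt0 rho_gt0 bq_ceiling_run small_step T0 vL (k0 := k0)).
by move=> k k0k i; rewrite -(win k.+1 (leqW k0k) i).
Qed.

Lemma consensus_value_upper v : consensus_value e Delta L rho r v -> - L < v ->
  v - rbar <= error_bound.
Proof.
move=> /consensus_value_window[k0 [T [T0 win]]]; rewrite ltrNl => vL.
have dev : n%:R * (v - rbar) = \sum_i (- r i - - v).
  by rewrite -opprB mulrN -sum_dev -sumrN; apply: eq_bigr => i _; ring.
rewrite -(ler_pM2l n_gt0) -sum_error_bound dev.
apply: (ceiling_mean_error Delta_gt0 rho_gt0 bq_floor_run small_step T0 vL (k0 := k0)).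
by move=> k k0k i; rewrite sumrN mulrN -(win k.+1 (leqW k0k) i).
Qed.

Lemma consensus_value_bounded v : consensus_value e Delta L rho r v -> `|v| <= L.
Proof.
move=> /consensus_value_window[k0 [T [T0 win]]].
case: He => n0 _ _ _; pose i : 'I_n := Ordinal n0.
have T0' : 0 < T%:R :> R by rewrite ltr0n.
rewrite -(ler_pM2l T0') -{1}(gtr0_norm T0') -normrM -(win k0 _ i) //.
apply: (le_trans (ler_norm_sum _ _ _)).
have -> : T%:R * L = \sum_(1 <= l < T.+1) L.
  by rewrite sumr_const_nat subn1 mulr_natl.
by apply: ler_sum => l _; rewrite ler_norml bquantizer_ge // bquantizer_le.
Qed.

End OneRun.

Hypothesis L_big : 5 * error_bound <= L.

Lemma mean_shift (r : 'I_n -> R) (a : R) :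
  n%:R^-1 * \sum_i (r i - a) = n%:R^-1 * \sum_i r i - a.
Proof.
by rewrite sumrB sumr_const card_ord mulrBr -[a *+ n]mulr_natl mulKf ?gt_eqF.
Qed.

(** By the one-sided error bounds, rbar has the sign of v and
    |rbar| >= L - error_bound >= 4 L / 5.  Subtracting L from a number at least
    4 L / 5 lowers its absolute value by at least 3 L / 5, the extreme case being
    4 L / 5, which is sent to - L / 5. *)
Lemma saturated_mean_drop (r : 'I_n -> R) v :
  consensus_value e Delta L rho r v -> `|v| = L ->
  `|n%:R^-1 * \sum_i (r i - Num.sg v * L)| + 3 / 5 * L
    <= `|n%:R^-1 * \sum_i r i|.
Proof.
move=> cv; rewrite mean_shift; set rbar := n%:R^-1 * _ => vL.
have L0 := L_gt0; have big := L_big.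
have [v0|v0|v0] := ltgtP v 0; last by move: vL L_gt0; rewrite v0 normr0 => ->; rewrite ltxx.
- have vL' : v = - L by move: vL; rewrite (ltr0_norm v0) => <-; rewrite opprK.
  have : rbar - v <= error_bound by apply: consensus_value_lower => //; lra.
  rewrite vL' ltr0_sg ?oppr_lt0 // => h.
  rewrite (ltr0_norm (_ : rbar < 0)); last lra.
  suff : `|rbar - -1 * L| <= - rbar - 3 / 5 * L by lra.
  by rewrite ler_norml; apply/andP; split; lra.
- have vL' : v = L by move: vL; rewrite (gtr0_norm v0).
  have : v - rbar <= error_bound by apply: consensus_value_upper => //; lra.
  rewrite vL' gtr0_sg // => h.
  rewrite (gtr0_norm (_ : 0 < rbar)); last lra.
  suff : `|rbar - 1 * L| <= rbar - 3 / 5 * L by lra.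
  by rewrite ler_norml; apply/andP; split; lra.
Qed.

Lemma ebq_cadmm_terminates (t r : 'I_n -> R) :
  exists t' v, ebq_cadmm e Delta L rho t r t' v.
Proof.
have step0 : 0 < 3 / 5 * L by have := L_gt0; lra.
have [N] : exists N, `|n%:R^-1 * \sum_i r i| < N%:R * (3 / 5 * L).
  exists (Num.truncn (`|n%:R^-1 * \sum_i r i| / (3 / 5 * L))).+1.
  by rewrite -ltr_pdivrMr // truncnS_gt.
elim: N t r => [t r|N IH t r lt].
  by rewrite mul0r ltNge normr_ge0.
have [v cv] := consensus_value_exists He Delta_gt0 L_gt0 rho_gt0 L_lattice r.
have [vL|nL] := eqVneq `|v| L; last first.
  by exists t, v; apply: ebq_stop => //; apply/eqP.
have drop := saturated_mean_drop cv vL.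
have [|t' [v' run]] := IH (fun i => t i + Num.sg v * L) (fun i => r i - Num.sg v * L).
  by move: drop lt; rewrite -natr1 mulrDl mul1r; lra.
by exists t', v'; exact: ebq_continue cv vL run.
Qed.

(** Every pass moves the same amount from all data to all t_i, so that t_i plus
    the mean of the current data is invariant; the last pass is accurate. *)
Lemma ebq_cadmm_correct (t r t' : 'I_n -> R) (v' t0 : R) :
  ebq_cadmm e Delta L rho t r t' v' -> (forall i, t i = t0) ->
  exists tstar, (forall i, t' i = tstar) /\
    `|tstar + v' - (t0 + n%:R^-1 * \sum_i r i)| <= error_bound.
Proof.
move=> run; elim: run t0 => {t r t' v'} [t r v cv nL|t r v t' v' cv vL _ IH] t0 tt0.
- exists t0; split=> //.
  have : `|v| < L by rewrite lt_neqAle (consensus_value_bounded cv) andbT; apply/eqP.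
  rewrite ltr_norml => /andP[lo hi].
  have h1 := consensus_value_lower cv hi; have h2 := consensus_value_upper cv lo.
  by rewrite ler_norml; apply/andP; split; lra.
- have [i|tstar [ht err]] := IH (t0 + Num.sg v * L); first by rewrite tt0.
  exists tstar; split=> //; move: err; rewrite mean_shift.
  by rewrite [X in _ - X](_ : _ = t0 + n%:R^-1 * \sum_i r i) //; ring.
Qed.

End Accuracy.

Theorem theorem3 (R : realType) (n : nat) (e : rel 'I_n) (Delta L rho : R)
    (He : connected_network e)
    (HDelta : 0 < Delta)
    (HL : 0 < L) (HLDelta : exists z : int, L = z%:~R * Delta)
    (Hrho : 0 < rho)
    (HGamma0 : Gamma0 n Delta L rho <= Delta / 2)
    (HLbig : 5 * (1 + 4 * rho * ((num_edges e)%:R / n%:R)) * (Delta / 2) <= L)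
    (r : 'I_n -> R) :
  let rbar := n%:R^-1 * \sum_(i < n) r i in
  (exists (t : 'I_n -> R) (xBQ : R),
      ebq_cadmm e Delta L rho (fun=> 0) r t xBQ) /\
  (forall (t : 'I_n -> R) (xBQ : R),
      ebq_cadmm e Delta L rho (fun=> 0) r t xBQ ->
      exists tstar : R,
        (forall i, t i = tstar) /\
        `|tstar + xBQ - rbar|
          <= (1 + 4 * rho * ((num_edges e)%:R / n%:R)) * (Delta / 2)).
Proof.
move=> rbar; split=> [|t xBQ run].
  by apply: ebq_cadmm_terminates => //; rewrite /error_bound mulrA.
have [tstar [ht err]] :=
  ebq_cadmm_correct He HDelta HL Hrho HLDelta HGamma0 run (fun=> erefl).
by exists tstar; split=> //; rewrite add0r in err.
Qed.
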